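(* The following two varieties are term equivalent: (i) the variety of hemiimplicative semilattices $(A,\wedge,\to,1)$ satisfying $a\to(a\wedge b)=a\to b$ for all $a,b\in A$; (ii) the variety of symmetric hemiimplicative semilattices $(A,\wedge,\sim,1)$ satisfying $a\sim b=(a\sim(a\wedge b))\wedge(b\sim(a\wedge b))$ for all $a,b\in A$.
   Context: A hemiimplicative semilattice is an algebra $(A,\wedge,\to,1)$ of type $(2,2,0)$ such that: $(A,\wedge,1)$ is a meet-semilattice with greatest element $1$ (with order $a\le b$ iff $a\wedge b=a$); $a\to a=1$ for every $a\in A$; and for all $a,b,c\in A$, if $a\le b\to c$ then $a\wedge b\le c$. A symmetric hemiimplicative semilattice is a hemiimplicative semilattice $(A,\wedge,\sim,1)$ (with $\sim$ playing the role of $\to$) such that $a\sim b=b\sim a$ for all $a,b\in A$. In a hemiimplicative semilattice $(A,\wedge,\to,1)$ one writes $a\leftrightarrow b:=(a\to b)\wedge(b\to a)$; in a symmetric hemiimplicative semilattice $(A,\wedge,\sim,1)$ one writes $a\Rightarrow b:=a\sim(a\wedge b)$ for the associated implication. Term equivalence of two varieties means that the basic operations of each are given by terms in the language of the other, in such a way that the two induced passages between algebras of the two varieties (on the same universe) are mutually inverse; here the passages are $(A,\wedge,\to,1)\mapsto(A,\wedge,\leftrightarrow,1)$ and $(A,\wedge,\sim,1)\mapsto(A,\wedge,\Rightarrow,1)$. *)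

(* Defs.v *)
From mathcomp Require Import all_boot.

Set Implicit Arguments.
Unset Strict Implicit.
Unset Printing Implicit Defensive.

(* Algebras of type (2,2,0) on the universe A.  The second binary operation is
   read as -> or as ~ according to the class of algebras considered. *)
Record algebra (A : Type) := Algebra {
  meet : A -> A -> A;
  arr : A -> A -> A;
  one : A
}.

(* Leibniz equality of records would require functional extensionality. *)
Definition same_operations (A : Type) (S T : algebra A) : Prop :=
  [/\ forall a b, meet S a b = meet T a b,
      forall a b, arr S a b = arr T a b
    & one S = one T].

(* Terms of type (2,2,0) in the variables x_0, ..., x_(n-1). *)
Inductive term (n : nat) : Type :=
  | Var of 'I_n
  | Meet of term n & term n
  | Arr of term n & term n
  | One.

Arguments One {n}.

Fixpoint eval (A : Type) (S : algebra A) (n : nat) (v : 'I_n -> A)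
    (t : term n) : A :=
  match t with
  | Var i => v i
  | Meet t u => meet S (eval S v t) (eval S v u)
  | Arr t u => arr S (eval S v t) (eval S v u)
  | One => one S
  end.

Definition algebra_class := forall A : Type, algebra A -> Prop.

Definition satisfies (A : Type) (S : algebra A) (n : nat) (t u : term n) :
    Prop :=
  forall v : 'I_n -> A, eval S v t = eval S v u.

Definition is_variety (V : algebra_class) : Prop :=
  exists E : forall n : nat, term n -> term n -> Prop,
    forall (A : Type) (S : algebra A),
      V A S <-> forall n (t u : term n), E n t u -> satisfies S t u.

Record interpretation := Interpretation {
  meet_term : term 2;
  arr_term : term 2;
  one_term : term 0
}.

Definition interpreted (I : interpretation) (A : Type) (S : algebra A) :
    algebra A :=
  Algebra (fun a b => eval S (tnth [tuple a; b]) (meet_term I))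
          (fun a b => eval S (tnth [tuple a; b]) (arr_term I))
          (eval S (tnth [tuple]) (one_term I)).

(* I gives the operations of W by terms in the language of V, and J those of V
   by terms in the language of W. *)
Definition term_equivalent_via (V W : algebra_class) (I J : interpretation) :
    Prop :=
  [/\ forall A (S : algebra A), V A S -> W A (interpreted I S),
      forall A (S : algebra A), W A S -> V A (interpreted J S),
      forall A (S : algebra A), V A S ->
        same_operations (interpreted J (interpreted I S)) S
    & forall A (S : algebra A), W A S ->
        same_operations (interpreted I (interpreted J S)) S].

Definition meet_le (A : Type) (S : algebra A) (a b : A) : Prop := meet S a b = a.

Record meet_semilattice_with_top (A : Type) (S : algebra A) : Prop := {
  meet_assoc : associative (meet S);
  meet_comm : commutative (meet S);
  meet_idem : idempotent_op (meet S);
  le_one : forall a, meet_le S a (one S)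
}.

Record hemiimplicative_semilattice (A : Type) (S : algebra A) : Prop := {
  hemi_semilattice : meet_semilattice_with_top S;
  arr_refl : forall a, arr S a a = one S;
  arr_elim : forall a b c, meet_le S a (arr S b c) -> meet_le S (meet S a b) c
}.

Record symmetric_hemiimplicative_semilattice (A : Type) (S : algebra A) :
    Prop := {
  sym_hemi : hemiimplicative_semilattice S;
  arr_comm : commutative (arr S)
}.

Definition hemi_arr_meet : algebra_class := fun A S =>
  hemiimplicative_semilattice S /\
  forall a b : A, arr S a (meet S a b) = arr S a b.

Definition sym_hemi_arr_meet : algebra_class := fun A S =>
  symmetric_hemiimplicative_semilattice S /\
  forall a b : A,
    arr S a b = meet S (arr S a (meet S a b)) (arr S b (meet S a b)).

Definition x0 : term 2 := Var ord0.
Definition x1 : term 2 := Var ord_max.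

(* (A, /\, ->, 1) |-> (A, /\, <->, 1),  a <-> b := (a -> b) /\ (b -> a) *)
Definition biimplication : interpretation :=
  Interpretation (Meet x0 x1) (Meet (Arr x0 x1) (Arr x1 x0)) One.

(* (A, /\, ~, 1) |-> (A, /\, =>, 1),  a => b := a ~ (a /\ b) *)
Definition associated_implication : interpretation :=
  Interpretation (Meet x0 x1) (Arr x0 (Meet x0 x1)) One.

(* Main.v *)
(* The quasi-identity "a <= b -> c implies a /\ b <= c" is equivalent, over
   semilattices, to the identity b /\ (b -> c) <= c, whence both classes are
   varieties.  For the translations, a -> (a /\ b) = a -> b forces
   (a /\ b) -> a = 1, so that a <-> (a /\ b) = a -> b; dually, the identity
   defining the second class says that ~ is the biimplication of =>. *)
Require Import Defs.
From mathcomp Require Import all_boot.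

Set Implicit Arguments.
Unset Strict Implicit.
Unset Printing Implicit Defensive.

Definition valid_in (V : algebra_class) n (t u : term n) : Prop :=
  forall A (S : algebra A), V A S -> satisfies S t u.

Definition models_theory (V : algebra_class) A (S : algebra A) : Prop :=
  forall n (t u : term n), valid_in V t u -> satisfies S t u.

(** The defining set of identities is taken to be the whole equational theory of [V]. Members of [V]
    satisfy it trivially, so only the converse inclusion is left to check. *)
Lemma is_variety_models (V : algebra_class) :
  (forall A (S : algebra A), models_theory V S -> V A S) -> is_variety V.
Proof.
move=> modV; exists (@valid_in V) => A S; split; last exact: modV.
by move=> VS n t u; apply.
Qed.

Section HemiimplicativeSemilattice.

Variables (A : Type) (S : algebra A).
Hypothesis hemiS : hemiimplicative_semilattice S.

Let latS : meet_semilattice_with_top S := hemi_semilattice hemiS.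

Lemma meet_one a : meet S a (Defs.one S) = a.
Proof. exact: (le_one latS). Qed.

Lemma meetKl a b : meet S a (meet S a b) = meet S a b.
Proof. by rewrite (meet_assoc latS) (meet_idem latS). Qed.

Lemma meet_le_l a b : meet_le S (meet S a b) a.
Proof. by rewrite /meet_le (meet_comm latS) meetKl. Qed.

Lemma meet_le_r a b : meet_le S (meet S a b) b.
Proof. by rewrite (meet_comm latS); apply: meet_le_l. Qed.

Lemma meet_le_trans a b c : meet_le S a b -> meet_le S b c -> meet_le S a c.
Proof. by rewrite /meet_le => <- bc; rewrite -(meet_assoc latS) bc. Qed.

Lemma arr_counit a b : meet_le S (meet S (arr S a b) a) b.
Proof. by apply: (arr_elim hemiS); apply: (meet_idem latS). Qed.

End HemiimplicativeSemilattice.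

(** Substituting [a = a /\ (b -> c)] turns [a /\ b] into [a /\ ((b -> c) /\ b)], whose second factor
    is below [c]. *)
Lemma arr_elim_of_counit A (S : algebra A) :
    meet_semilattice_with_top S ->
    (forall a b, meet_le S (meet S (arr S a b) a) b) ->
  forall a b c, meet_le S a (arr S b c) -> meet_le S (meet S a b) c.
Proof.
move=> latS counit a b c; rewrite /meet_le => abc.
by rewrite -abc -!(meet_assoc latS) (meet_assoc latS _ b) counit.
Qed.

(** Keeping [V] arbitrary lets both classes share this argument: each axiom is put as an identity in
    at most three variables, valid throughout [V], and so passes to [S]. *)
Lemma hemiimplicative_models (V : algebra_class) :
    (forall A (S : algebra A), V A S -> hemiimplicative_semilattice S) ->
  forall A (S : algebra A),
    models_theory V S -> hemiimplicative_semilattice S.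
Proof.
move=> hemiV A S modS.
pose x : term 3 := Var ord0.
pose y : term 3 := Var (@Ordinal 3 1 isT).
pose z : term 3 := Var ord_max.
(* Identities with fewer than three variables repeat [a] in the coordinates they do not read. *)
pose val3 (a b c : A) := tnth [tuple a; b; c].
have latS : meet_semilattice_with_top S.
  split=> [a b c|a b|a|a].
  - apply: (modS _ (Meet x (Meet y z)) (Meet (Meet x y) z) _ (val3 a b c)).
    by move=> B T /hemiV/hemi_semilattice[meetA _ _ _] v; apply: meetA.
  - apply: (modS _ (Meet x y) (Meet y x) _ (val3 a b a)).
    by move=> B T /hemiV/hemi_semilattice[_ meetC _ _] v; apply: meetC.
  - apply: (modS _ (Meet x x) x _ (val3 a a a)).
    by move=> B T /hemiV/hemi_semilattice[_ _ meetxx _] v; apply: meetxx.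
  - apply: (modS _ (Meet x One) x _ (val3 a a a)).
    by move=> B T /hemiV/meet_one meetx1 v; apply: meetx1.
split=> //.
- move=> a; apply: (modS _ (Arr x x) One _ (val3 a a a)).
  by move=> B T /hemiV/arr_refl arrxx v; apply: arrxx.
(* The elimination rule is not an identity, so its equational form is transferred instead. *)
- apply: arr_elim_of_counit => // a b.
  apply: (modS _ (Meet (Meet (Arr x y) x) y) (Meet (Arr x y) x) _ (val3 a b a)).
  by move=> B T /hemiV/arr_counit counit v; apply: counit.
Qed.

Lemma hemi_arr_meet_variety : is_variety hemi_arr_meet.
Proof.
apply: is_variety_models => A S modS; split.
  by apply: hemiimplicative_models modS => B T [].
move=> a b; apply: (modS _ (Arr x0 (Meet x0 x1)) (Arr x0 x1) _
  (tnth [tuple a; b])).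
by move=> B T [_ arrM] v; apply: arrM.
Qed.

Lemma sym_hemi_arr_meet_variety : is_variety sym_hemi_arr_meet.
Proof.
apply: is_variety_models => A S modS; split; first split.
- by apply: hemiimplicative_models modS => B T [[]].
- move=> a b; apply: (modS _ (Arr x0 x1) (Arr x1 x0) _ (tnth [tuple a; b])).
  by move=> B T [[_ arrC] _] v; apply: arrC.
- move=> a b; apply: (modS _ (Arr x0 x1)
    (Meet (Arr x0 (Meet x0 x1)) (Arr x1 (Meet x0 x1))) _ (tnth [tuple a; b])).
  by move=> B T [_ arrM] v; apply: arrM.
Qed.

(** The second factor is [1]: the class identity rewrites [(a /\ b) -> a] to
    [(a /\ b) -> ((a /\ b) /\ a)], which is [(a /\ b) -> (a /\ b)]. The left side is
    [a <-> (a /\ b)], so this also gives one round trip. *)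
Lemma biimplication_meet A (S : algebra A) : hemi_arr_meet S ->
  forall a b,
    meet S (arr S a (meet S a b)) (arr S (meet S a b) a) = arr S a b.
Proof.
move=> [hemiS arrM] a b; rewrite arrM -(arrM (meet S a b)).
by rewrite (meet_le_l hemiS) (arr_refl hemiS) (meet_one hemiS).
Qed.

Lemma interpreted_semilattice (I : interpretation) A (S : algebra A) :
    meet_term I = Meet x0 x1 -> one_term I = One ->
  meet_semilattice_with_top S -> meet_semilattice_with_top (interpreted I S).
Proof.
case: I => _ arrI _ /= -> -> [meetA meetC meetxx le1]; split.
- exact: meetA.
- exact: meetC.
- exact: meetxx.
- exact: le1.
Qed.

Lemma biimplication_sym_hemi A (S : algebra A) :
  hemi_arr_meet S -> sym_hemi_arr_meet (interpreted biimplication S).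
Proof.
move=> VS; have [hemiS arrM] := VS; have latS := hemi_semilattice hemiS.
split; first split; first split.
- exact: interpreted_semilattice.
- by move=> a; rewrite /= (arr_refl hemiS) (meet_one hemiS).
(* Elimination is inherited because [b <-> c] lies below [b -> c]. *)
- move=> a b c le_a; apply: (arr_elim hemiS).
  exact: (meet_le_trans hemiS le_a (meet_le_l hemiS _ _)).
- by move=> a b; apply: (meet_comm latS).
- move=> a b.
  (* With the terms evaluated, the two factors on the right are [a <-> (a /\ b)] and
     [b <-> (a /\ b)], which collapse to [a -> b] and [b -> a]. *)
  change (meet S (arr S a b) (arr S b a) =
    meet S (meet S (arr S a (meet S a b)) (arr S (meet S a b) a))
           (meet S (arr S b (meet S a b)) (arr S (meet S a b) b))).
  by rewrite biimplication_meet // (meet_comm latS a) biimplication_meet.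
Qed.

Lemma associated_implication_hemi A (S : algebra A) :
  sym_hemi_arr_meet S -> hemi_arr_meet (interpreted associated_implication S).
Proof.
move=> [[hemiS arrC] arrM]; have latS := hemi_semilattice hemiS.
split; first split.
- exact: interpreted_semilattice.
- move=> a; change (arr S a (meet S a a) = Defs.one S).
  by rewrite (meet_idem latS) (arr_refl hemiS).
- move=> a b c le_a.
  (* Here [le_a] reads [a <= b ~ (b /\ c)], so elimination for [~] bounds [a /\ b] by [b /\ c],
     hence by [c]. *)
  have le_bc : meet_le S (meet S a b) (meet S b c).
    exact: (arr_elim hemiS) le_a.
  exact: (meet_le_trans hemiS le_bc (meet_le_r hemiS _ _)).
- move=> a b.
  change (arr S a (meet S a (meet S a b)) = arr S a (meet S a b)).
  by rewrite (meetKl hemiS).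
Qed.

Theorem corollary3p11 :
  [/\ is_variety hemi_arr_meet,
      is_variety sym_hemi_arr_meet
    & term_equivalent_via hemi_arr_meet sym_hemi_arr_meet
        biimplication associated_implication].
Proof.
split; [exact: hemi_arr_meet_variety|exact: sym_hemi_arr_meet_variety|split].
- exact: biimplication_sym_hemi.
- exact: associated_implication_hemi.
- by move=> A S VS; split=> // a b; apply: biimplication_meet.
- move=> A S [[hemiS arrC] arrM]; split=> // a b.
  (* Unfolded, [(a => b) /\ (b => a)] matches the identity defining the second class up to commuting
     [b /\ a]. *)
  change (meet S (arr S a (meet S a b)) (arr S b (meet S b a)) = arr S a b).
  by rewrite (meet_comm (hemi_semilattice hemiS) b) -arrM.
Qed.
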